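(* Let $S_1 = (\mathcal{X}_1, \mathcal{U}_1, \rightsquigarrow_1)$ and $S_2 = (\mathcal{X}_2, \mathcal{U}_2, \rightsquigarrow_2)$ be discrete-time control systems, and let $R \subseteq \mathcal{X}_1 \times \mathcal{X}_2$ be an alternating simulation relation, with associated extended alternating simulation relation $R^e$, such that for each $x_1 \in \mathcal{X}_1$ there is exactly one $x_2 \in \mathcal{X}_2$ with $(x_1, x_2) \in R$; denote this $x_2$ by $R(x_1)$. Given a cost function $c_1$ for $S_1$, consider an associated cost function $c_2$ for $S_2$ satisfying $$c_2(x_2, u_2) \le \min_{(x_1, x_2, u_1, u_2) \in R^e} c_1(x_1, u_1),$$ where for given $(x_2,u_2)$ the minimum is over all $(x_1,u_1)$ with $(x_1,x_2,u_1,u_2)\in R^e$. If $V_2$ is a Bellman-like value function for $S_2$ with cost function $c_2$, then $V_1(x_1) = V_2(R(x_1))$ is a Bellman-like value function for $S_1$ with cost function $c_1$.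
   Context: A discrete-time control system is a triple $S = (\mathcal{X}, \mathcal{U}, \rightsquigarrow)$ with state set $\mathcal{X}$, input set $\mathcal{U}$, and $\rightsquigarrow$ the set of transitions $(x,u,x')$ such that the system can reach $x'\in\mathcal{X}$ from $x\in\mathcal{X}$ with input $u\in\mathcal{U}$. $\mathrm{Post}_u(x)$ denotes the set of $x'$ such that $(x,u,x') \in\ \rightsquigarrow$; for $S_i$ it is written $\mathrm{Post}_{i,u}(x)$. Given a relation $R \subseteq \mathcal{X}_1\times \mathcal{X}_2$, the extended relation $R^e$ is the set of $(x_1,x_2,u_1,u_2)$ such that for every $x_2' \in \mathrm{Post}_{2,u_2}(x_2)$ there exists $x_1' \in \mathrm{Post}_{1,u_1}(x_1)$ with $(x_1', x_2') \in R$. If for all $(x_1,x_2) \in R$ and for all $u_1 \in \mathcal{U}_1$ there exists $u_2 \in \mathcal{U}_2$ such that $(x_1,x_2,u_1,u_2) \in R^e$, then $R$ is an alternating simulation relation and $R^e$ is its associated extended alternating simulation relation. A cost function is a function $c:\mathcal{X}\times\mathcal{U}\to\mathbb{R}$ and a value function is a function $V:\mathcal{X}\to\mathbb{R}$. A value function $V$ is a Bellman-like value function of $S$ with cost function $c$ if $V(x) \le \mathcal{T}_c V(x)$ for all $x \in \mathcal{X}$, where $$\mathcal{T}_c V(x) = \min_{u \in \mathcal{U}} \Big( c(x,u) + \max_{x' \in \mathrm{Post}_u(x)} V(x') \Big).$$ *)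

(* Defs.v *)
From mathcomp Require Import all_boot all_order all_algebra.
From mathcomp Require Import all_classical all_reals all_analysis.

Set Implicit Arguments.
Unset Strict Implicit.
Unset Printing Implicit Defensive.

Local Open Scope classical_set_scope.
Local Open Scope ring_scope.
Local Open Scope ereal_scope.

Record control_system := ControlSystem {
  state : Type;
  input : Type;
  trans : set (state * input * state) }.

Definition Post (S : control_system) (u : input S) (x : state S) :
    set (state S) :=
  [set x' | trans (x, u, x')].

Definition ext_rel (S1 S2 : control_system) (Rel : set (state S1 * state S2)) :
    set (state S1 * state S2 * input S1 * input S2) :=
  [set p | let: (x1, x2, u1, u2) := p in
    forall x2', Post u2 x2 x2' ->
      exists x1', Post u1 x1 x1' /\ Rel (x1', x2')].

Definition alternating_simulation (S1 S2 : control_system)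
    (Rel : set (state S1 * state S2)) : Prop :=
  forall x1 x2, Rel (x1, x2) ->
    forall u1, exists u2, ext_rel Rel (x1, x2, u1, u2).

Definition functional_rel (X1 X2 : Type) (Rel : set (X1 * X2)) : Prop :=
  forall x1, exists! x2, Rel (x1, x2).

Lemma functional_rel_ex (X1 X2 : Type) (Rel : set (X1 * X2)) :
  functional_rel Rel -> forall x1, exists x2, Rel (x1, x2).
Proof. by move=> h x1; have [x2 [Rx2 _]] := h x1; exists x2. Qed.

Definition rel_fun (X1 X2 : Type) (Rel : set (X1 * X2))
    (h : functional_rel Rel) (x1 : X1) : X2 :=
  sval (cid (functional_rel_ex h x1)).

Lemma rel_funP (X1 X2 : Type) (Rel : set (X1 * X2))
    (h : functional_rel Rel) (x1 : X1) : Rel (x1, rel_fun h x1).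
Proof. exact: svalP (cid (functional_rel_ex h x1)). Qed.

(* Minima and maxima are taken as infima and suprema in the extended reals:
   they agree with min and max whenever these are attained, and the max over
   an empty set is -oo, the min over an empty set +oo. *)

Definition bellman_op (R : realType) (S : control_system)
    (c : state S -> input S -> R) (V : state S -> R) (x : state S) : \bar R :=
  ereal_inf [set (c x u)%:E + ereal_sup [set (V x')%:E | x' in Post u x]
            | u in [set: input S]].

Definition bellman_like (R : realType) (S : control_system)
    (c : state S -> input S -> R) (V : state S -> R) : Prop :=
  forall x, (V x)%:E <= bellman_op c V x.

(* The minimum is over all pairs (x1, u1) with (x1, x2, u1, u2) in the
   extended relation; (x1, x2) itself is not required to be related. *)
Definition min_related_cost (R : realType) (S1 S2 : control_system)
    (Rel : set (state S1 * state S2)) (c1 : state S1 -> input S1 -> R)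
    (x2 : state S2) (u2 : input S2) : \bar R :=
  ereal_inf [set (c1 p.1 p.2)%:E
            | p in [set p | ext_rel Rel (p.1, x2, p.2, u2)]].

(* Main.v *)
Require Import Defs.
From mathcomp Require Import all_boot all_order all_algebra.
From mathcomp Require Import all_classical all_reals all_analysis.

Set Implicit Arguments.
Unset Strict Implicit.
Unset Printing Implicit Defensive.

Import Order.TTheory.

Local Open Scope classical_set_scope.
Local Open Scope ring_scope.
Local Open Scope ereal_scope.

(** Fix a state [x1] and an input [u1] of [S1]. Alternating simulation supplies an input [u2] at the
    image of [x1] whose every successor is the image of some successor of [x1] under [u1]. So [u2]
    has no larger worst-case value ([ext_rel_sup_le]) and, by the bound on [c2], no larger stage
    cost. The Bellman inequality for [V2], read at [u2], thus gives the one for [u1], and [u1] is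
    arbitrary. *)

Lemma rel_fun_eq (X1 X2 : Type) (Rel : set (X1 * X2))
    (h : functional_rel Rel) (x1 : X1) (x2 : X2) :
  Rel (x1, x2) -> rel_fun h x1 = x2.
Proof.
move=> Rx; have [y [_ uniq_y]] := h x1.
by rewrite -(uniq_y _ Rx) -(uniq_y _ (rel_funP h x1)).
Qed.

Lemma ge_min_related_cost (R : realType) (S1 S2 : control_system)
    (Rel : set (state S1 * state S2)) (c1 : state S1 -> input S1 -> R)
    x1 x2 u1 u2 :
  ext_rel Rel (x1, x2, u1, u2) ->
  min_related_cost Rel c1 x2 u2 <= (c1 x1 u1)%:E.
Proof. by move=> He; apply: ereal_inf_lbound; exists (x1, u1). Qed.

(** Every value on the left also occurs on the right: a successor [x2'] is matched by some [x1'],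
    whose only related state is [x2']. Empty successor sets need no separate case. *)
Lemma ext_rel_sup_le (R : realType) (S1 S2 : control_system)
    (Rel : set (state S1 * state S2)) (h : functional_rel Rel)
    (V : state S2 -> R) x1 x2 u1 u2 :
  ext_rel Rel (x1, x2, u1, u2) ->
  ereal_sup [set (V x)%:E | x in Post u2 x2] <=
  ereal_sup [set (V (rel_fun h x))%:E | x in Post u1 x1].
Proof.
move=> He; apply: ereal_sup_le => _ [x2' /He [x1' [Px1' Rx']] <-].
by exists x1' => //; rewrite (rel_fun_eq h Rx').
Qed.

Theorem theorem6 (R : realType) (S1 S2 : control_system)
    (Rel : set (state S1 * state S2))
    (hsim : alternating_simulation Rel)
    (hfun : functional_rel Rel)
    (c1 : state S1 -> input S1 -> R) (c2 : state S2 -> input S2 -> R)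
    (hc : forall x2 u2, (c2 x2 u2)%:E <= min_related_cost Rel c1 x2 u2)
    (V2 : state S2 -> R)
    (hV2 : bellman_like c2 V2) :
  bellman_like c1 (fun x1 => V2 (rel_fun hfun x1)).
Proof.
move=> x1; apply: le_ereal_inf_tmp => _ [u1 _ <-].
have [u2 He] := hsim _ _ (rel_funP hfun x1) u1.
apply: le_trans (hV2 _) _.
(* The infimum over inputs of [S2] is bounded by its term at the matching [u2]. *)
apply: (@le_trans _ _ ((c2 (rel_fun hfun x1) u2)%:E +
  ereal_sup [set (V2 x)%:E | x in Post u2 (rel_fun hfun x1)])).
  by apply: ereal_inf_lbound; exists u2.
(* For the costs, [He] makes [(x1, u1)] a competitor in the minimum bounding [c2]. *)
apply: leeD (ext_rel_sup_le _ _ He).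
exact: le_trans (hc _ _) (ge_min_related_cost _ He).
Qed.
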